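(* Let $T\in\mathcal B(\mathcal H)$. Then $T$ induces an invertible operator in $\mathcal B(\mathcal H,\mathcal R(T)\mathcal H)$ if and only if there exists a projection $E\in\mathcal B(\mathcal H)$ such that: (1) there exist $a_1,a_2\in(0,\infty)$ with $\|TE\xi\|\ge a_1\|E\xi\|$ and $\|T(I-E)\xi\|\ge a_2\|(I-E)\xi\|$ for every $\xi\in\mathcal H$; (2) $\mathcal R(TE)-\mathcal R(T(I-E))$ is invertible in $\mathcal B(\mathcal R(T)\mathcal H)$. If (1) and (2) are satisfied, then, writing $T^{-1}$ for the inverse of the induced operator $\mathcal H\to\mathcal R(T)\mathcal H$, $$\frac{1}{\|T\|}\le\sqrt{1-\|\mathcal R(TE)\mathcal R(T(I-E))\|}\,\|T^{-1}\|\le\frac{1}{\min(a_1,a_2)}.$$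
   Context: For $S\in\mathcal B(\mathcal H)$, $\mathcal R(S)$ denotes the orthogonal projection onto the closure of the range of $S$. *)

(* Defs.v *)
(* MathComp + mathcomp-real-closed (complex R = R[i])
   + mathcomp-analysis reals (sup on a realType). *)
From mathcomp Require Import all_boot all_algebra.
From mathcomp Require Import complex.
From mathcomp Require Import all_classical reals.
From Stdlib Require Import ClassicalEpsilon.
Import GRing.Theory Num.Theory.
Set Implicit Arguments. Unset Strict Implicit. Unset Printing Implicit Defensive.
Local Open Scope ring_scope.
Local Open Scope classical_set_scope.

Section Hilbert.
Variables (R : realType) (V : lmodType R[i]) (ip : V -> V -> R[i]).

(* norm induced by the inner product *)
Definition hnorm (x : V) : R := Num.sqrt (complex.Re (ip x x)).

Definition cauchy_seq (u : nat -> V) : Prop :=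
  forall e : R, 0 < e -> exists N : nat, forall m n : nat,
    (N <= m)%N -> (N <= n)%N -> hnorm (u m - u n) < e.

Definition converges (u : nat -> V) : Prop :=
  exists l : V, forall e : R, 0 < e -> exists N : nat, forall n : nat,
    (N <= n)%N -> hnorm (u n - l) < e.

(* ip is an inner product (linear in the first variable, conjugate symmetric,
   positive definite) and V is complete for the induced norm *)
Definition is_hilbert : Prop :=
  [/\ (forall (a : R[i]) (x y z : V), ip (a *: x + y) z = a * ip x z + ip y z),
      (forall x y : V, ip y x = (ip x y)^*),
      (forall x : V, 0 <= ip x x),
      (forall x : V, ip x x = 0 -> x = 0)
    & (forall u : nat -> V, cauchy_seq u -> converges u)].

(* elements of B(H) *)
Definition is_linear_op (T : V -> V) : Prop :=
  forall (a : R[i]) (x y : V), T (a *: x + y) = a *: T x + T y.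

Definition bounded_op (T : V -> V) : Prop :=
  is_linear_op T /\ exists C : R, forall x : V, hnorm (T x) <= C * hnorm x.

(* operator norm on B(H) *)
Definition opnorm (T : V -> V) : R :=
  sup [set hnorm (T x) | x in [set x : V | hnorm x <= 1]].

(* norm of an operator defined on the subspace K (as an element of B(K, H)) *)
Definition opnorm_on (K : set V) (S : V -> V) : R :=
  sup [set hnorm (S y) | y in [set y : V | K y /\ hnorm y <= 1]].

(* a projection in B(H): self-adjoint idempotent *)
Definition is_projection (E : V -> V) : Prop :=
  [/\ bounded_op E, (forall x : V, E (E x) = E x)
    & (forall x y : V, ip (E x) y = ip x (E y))].

(* norm closure *)
Definition hclosure (A : set V) : set V :=
  [set x | forall e : R, 0 < e -> exists2 a, A a & hnorm (x - a) < e].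

(* P is the orthogonal projection onto the closure of the range of S *)
Definition is_range_proj (S P : V -> V) : Prop :=
  is_projection P /\ range P = hclosure (range S).

(* R(S) (chosen by description; it is unique and exists in a Hilbert space) *)
Definition rproj (S : V -> V) : V -> V :=
  epsilon (inhabits (fun x : V => x)) (is_range_proj S).

(* the subspace R(S)H *)
Definition rspace (S : V -> V) : set V := range (rproj S).

(* S is a linear, bounded operator on the subspace K *)
Definition bounded_on (K : set V) (S : V -> V) : Prop :=
  (forall (a : R[i]) (x y : V), K x -> K y -> S (a *: x + y) = a *: S x + S y)
  /\ exists C : R, forall y : V, K y -> hnorm (S y) <= C * hnorm y.

(* Tinv is the inverse in B(K, H) of T seen as an operator H -> K *)
Definition is_inverse_onto (K : set V) (T Tinv : V -> V) : Prop :=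
  [/\ forall x : V, Tinv (T x) = x,
      forall y : V, K y -> T (Tinv y) = y
    & bounded_on K Tinv].

(* T induces an invertible operator in B(H, K) *)
Definition invertible_onto (K : set V) (T : V -> V) : Prop :=
  (forall x : V, K (T x)) /\ exists Tinv : V -> V, is_inverse_onto K T Tinv.

(* A (mapping K into K) is invertible in B(K) *)
Definition invertible_in (K : set V) (A : V -> V) : Prop :=
  (forall y : V, K y -> K (A y)) /\
  exists B : V -> V, [/\ forall y : V, K y -> K (B y),
                        forall y : V, K y -> A (B y) = y,
                        forall y : V, K y -> B (A y) = y
                      & bounded_on K B].

End Hilbert.

(* Main.v *)
(** If [T] is invertible onto [K = R(T)H], then [E = 1] satisfies (1) and (2).
    Conversely, by (1) the ranges of [TE] and [T(1 - E)] are closed, so the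
    projections [P] and [Q] of (2) project onto these ranges themselves;
    surjectivity of [P - Q] on [K] makes them span [K], and injectivity makes
    them meet in 0.
    For the norm estimates put [s = |PQ|].  For [x] in [EH] and [y] in [(1-E)H],
    orthogonality gives [|x + y|^2 = |x|^2 + |y|^2], while [Tx] and [Ty] satisfy
    [|Re <Tx, Ty>| <= s |Tx| |Ty|], so [|T(x + y)|^2 >= (1 - s)(|Tx|^2 + |Ty|^2)];
    this is the upper bound.  The lower bound comes from almost optimal pairs
    [Tx], [Ty] of equal norm, for which [|Tx - Ty|^2 = 2 (1 - s) |Tx|^2]. *)
Require Import Defs.
From mathcomp Require Import all_boot all_order all_algebra.
From mathcomp Require Import complex.
From mathcomp Require Import all_classical reals.
From mathcomp Require Import ring lra.
Import Order.TTheory GRing.Theory Num.Theory.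
Local Open Scope ring_scope.
Local Open Scope classical_set_scope.

Set Implicit Arguments. Unset Strict Implicit. Unset Printing Implicit Defensive.

Section HilbertSpace.
Variables (R : realType) (V : lmodType R[i]) (ip : V -> V -> R[i]).
Hypothesis hH : is_hilbert ip.
Implicit Types (x y z : V) (r : R) (S T E F P : V -> V) (M K : set V).

Local Notation hn := (hnorm ip).
Local Notation "r *r x" := (r%:C%C *: x) (at level 40, left associativity).

(** * The real part of the inner product, and the norm *)

(** Real-valued, symmetric and real-bilinear, so that norm computations come within reach of [ring]
    and [lra]. Complex orthogonality is recovered from it by testing also against ['i%C *: m]. *)
Definition rip x y : R := complex.Re (ip x y).

Lemma ip_linear (a : R[i]) x y z : ip (a *: x + y) z = a * ip x z + ip y z.
Proof. by case: hH. Qed.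

Lemma ipC x y : ip y x = (ip x y)^*.
Proof. by case: hH. Qed.

Lemma ip0l z : ip 0 z = 0.
Proof.
have := ip_linear 1 0 0 z.
by rewrite scaler0 addr0 mul1r => /esym /(canRL (addrK _)); rewrite subrr.
Qed.

Lemma ipDl x y z : ip (x + y) z = ip x z + ip y z.
Proof. by rewrite -{1}[x]scale1r ip_linear mul1r. Qed.

Lemma ipZl (a : R[i]) x z : ip (a *: x) z = a * ip x z.
Proof. by rewrite -[a *: x]addr0 ip_linear ip0l addr0. Qed.

Lemma ipBl x y z : ip (x - y) z = ip x z - ip y z.
Proof. by rewrite -scaleN1r ipDl ipZl mulN1r. Qed.

Lemma ipBr x y z : ip z (x - y) = ip z x - ip z y.
Proof. by rewrite ipC ipBl rmorphB /= -!ipC. Qed.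

Lemma ripC x y : rip x y = rip y x.
Proof. by rewrite /rip (ipC y x); case: (ip y x). Qed.

Lemma ripDl x y z : rip (x + y) z = rip x z + rip y z.
Proof. by rewrite /rip ipDl; case: (ip x z) (ip y z) => ? ? []. Qed.

Lemma ripZl r x z : rip (r *r x) z = r * rip x z.
Proof. by rewrite /rip ipZl; case: (ip x z) => a b /=; rewrite mul0r subr0. Qed.

Lemma ripNl x z : rip (- x) z = - rip x z.
Proof. by rewrite -scaleN1r /rip ipZl mulN1r; case: (ip x z). Qed.

Lemma ripDr x y z : rip z (x + y) = rip z x + rip z y.
Proof. by rewrite !(ripC z) ripDl. Qed.

Lemma ripZr r x z : rip z (r *r x) = r * rip z x.
Proof. by rewrite !(ripC z) ripZl. Qed.

Lemma ripNr x z : rip z (- x) = - rip z x.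
Proof. by rewrite !(ripC z) ripNl. Qed.

Definition ripE := (ripDl, ripDr, ripNl, ripNr, ripZl, ripZr).

Lemma rip_ge0 x : 0 <= rip x x.
Proof.
case: hH => _ _ /(_ x); rewrite lecE /rip => h _ _.
by case/andP: h.
Qed.

Lemma rip_eq0 x : rip x x = 0 -> x = 0.
Proof.
case: hH => _ _ /(_ x) + /(_ x) + _; rewrite lecE /rip.
case: (ip x x) => a b /= /andP[/eqP -> _] h a0; apply: h.
by rewrite a0.
Qed.

Lemma hnorm_ge0 x : 0 <= hn x.
Proof. exact: sqrtr_ge0. Qed.

Lemma hnorm_sqr x : hn x ^+ 2 = rip x x.
Proof. by rewrite sqr_sqrtr ?rip_ge0. Qed.

Lemma hnorm_eq0 x : hn x = 0 -> x = 0.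
Proof. by move=> h; apply: rip_eq0; rewrite -hnorm_sqr h expr0n. Qed.

Lemma hnormZ r x : hn (r *r x) = `|r| * hn x.
Proof.
apply: (@pexpIrn _ 2%N) => //; rewrite ?nnegrE ?mulr_ge0 ?hnorm_ge0//.
by rewrite exprMn real_normK ?num_real// !hnorm_sqr !ripE; ring.
Qed.

Lemma hnormN x : hn (- x) = hn x.
Proof. by rewrite /hnorm -!/(rip _ _) !ripE opprK. Qed.

Lemma hnormBC x y : hn (x - y) = hn (y - x).
Proof. by rewrite -hnormN opprB. Qed.

Lemma hnorm0 : hn 0 = 0.
Proof. by rewrite /hnorm ip0l sqrtr0. Qed.

Lemma hnorm_le r x : 0 <= r -> rip x x <= r ^+ 2 -> hn x <= r.
Proof.
by move=> r0; rewrite -hnorm_sqr ler_sqr ?nnegrE ?hnorm_ge0.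
Qed.

Lemma cauchy_schwarz x y : rip x y <= hn x * hn y.
Proof.
have [y0|y0] := eqVneq (hn y) 0.
  by rewrite (hnorm_eq0 y0) ripC /rip ip0l hnorm0 mulr0.
have yp : 0 < hn y by rewrite lt_def y0 hnorm_ge0.
(* This square expands to [2 |x| |y| (|x| |y| - rip x y)]. *)
have := rip_ge0 (hn y *r x - hn x *r y).
rewrite !ripE (ripC y x) -!hnorm_sqr => h.
have [x0|x0] := eqVneq (hn x) 0.
  by rewrite (hnorm_eq0 x0) /rip ip0l hnorm0 mul0r.
have xp : 0 < hn x by rewrite lt_def x0 hnorm_ge0.
have p : 0 < hn x * hn y by rewrite mulr_gt0.
rewrite -(ler_pM2l p); lra.
Qed.

Lemma hnormD x y : hn (x + y) <= hn x + hn y.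
Proof.
apply: hnorm_le; first by rewrite addr_ge0 ?hnorm_ge0.
rewrite !ripE (ripC y x) sqrrD !hnorm_sqr.
by have := cauchy_schwarz x y; lra.
Qed.

Lemma hnormB_triangle z x y : hn (x - y) <= hn (x - z) + hn (z - y).
Proof. by rewrite -[x - y](subrKA z); apply: hnormD. Qed.

Lemma small_eq0 r : 0 <= r -> (forall e : R, 0 < e -> r < e) -> r = 0.
Proof.
move=> r0 h; apply/eqP; rewrite eq_le r0 andbT leNgt; apply/negP => rp.
by have := h r rp; rewrite ltxx.
Qed.

(** * Linear operators, subspaces and closures *)

Lemma linearD S x y : is_linear_op S -> S (x + y) = S x + S y.
Proof. by move=> /(_ 1 x y); rewrite !scale1r. Qed.

Lemma linear0 S : is_linear_op S -> S 0 = 0.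
Proof.
by move=> /(_ (-1) 0 0); rewrite scaler0 addr0 scaleN1r addNr.
Qed.

Lemma linearZ S (a : R[i]) x : is_linear_op S -> S (a *: x) = a *: S x.
Proof. by move=> lS; rewrite -[a *: x]addr0 lS linear0 ?addr0. Qed.

Lemma linearB S x y : is_linear_op S -> S (x - y) = S x - S y.
Proof.
by move=> lS; rewrite -!(scaleN1r y) addrC lS scaleN1r addrC.
Qed.

Lemma bounded_opP S : bounded_op ip S ->
  exists2 C : R, 0 < C & forall x, hn (S x) <= C * hn x.
Proof.
case=> _ [C hC]; exists (`|C| + 1); first by rewrite ltr_wpDl.
move=> x; apply: le_trans (hC x) _; rewrite ler_wpM2r ?hnorm_ge0//.
by rewrite ler_wpDr// ler_norm.
Qed.

Definition subspace M := M 0 /\ forall (a : R[i]) x y, M x -> M y -> M (a *: x + y).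

Lemma subspaceD M x y : subspace M -> M x -> M y -> M (x + y).
Proof. by move=> [_ h] hx hy; rewrite -[x]scale1r; apply: h. Qed.

Lemma subspaceZ M (a : R[i]) x : subspace M -> M x -> M (a *: x).
Proof. by move=> [h0 h] hx; rewrite -[_ *: _]addr0; apply: h. Qed.

Lemma subspaceB M x y : subspace M -> M x -> M y -> M (x - y).
Proof.
by move=> h hx hy; rewrite -scaleN1r; apply: subspaceD => //; apply: subspaceZ.
Qed.

Lemma range_subspace S : is_linear_op S -> subspace (range S).
Proof.
move=> lS; split; first by exists 0 => //; exact: linear0.
by move=> a _ _ [x _ <-] [y _ <-]; exists (a *: x + y).
Qed.

Lemma sub_hclosure M : M `<=` hclosure ip M.
Proof. by move=> x Mx e e0; exists x => //; rewrite subrr hnorm0. Qed.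

Lemma hclosureK M : hclosure ip (hclosure ip M) `<=` hclosure ip M.
Proof.
move=> x hx e e0.
have e2 : 0 < e / 2 by lra.
have [y hy xy] := hx _ e2; have [z Mz yz] := hy _ e2.
by exists z => //; have := hnormB_triangle y x z; lra.
Qed.

(** Multiplication by ['i%C] is isometric, so splitting [a] into real and imaginary parts reduces to
    [hnormZ]. A crude constant is enough to show that closures are stable under complex scalars; the
    summand 1 makes it safe to divide by. *)
Lemma hnormZ_le (a : R[i]) : exists2 C : R, 0 < C & forall x, hn (a *: x) <= C * hn x.
Proof.
exists (`|complex.Re a| + `|complex.Im a| + 1); first by rewrite ltr_wpDl// addr_ge0.
have imul x : hn ('i%C *: x) = hn x.
  rewrite /hnorm ipZl ipC ipZl rmorphM /= -ipC.
  by case: (ip x x) => u v /=; congr Num.sqrt; ring.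
move=> x; have -> : a *: x = complex.Re a *r x + complex.Im a *r ('i%C *: x).
  rewrite scalerA -scalerDl; congr (_ *: _).
  by case: a => u v; simpc.
apply: le_trans (hnormD _ _) _; rewrite !hnormZ imul.
by have := hnorm_ge0 x; lra.
Qed.

Lemma hclosure_subspace M : subspace M -> subspace (hclosure ip M).
Proof.
move=> sM; split; first by apply: sub_hclosure; case: sM.
move=> a x y hx hy e e0; have [C C0 hC] := hnormZ_le a.
have [u Mu xu] := hx (e / 2 / C) ltac:(by rewrite !divr_gt0).
have [v Mv yv] := hy (e / 2) ltac:(by rewrite divr_gt0).
exists (a *: u + v); first by case: sM => _; apply.
rewrite opprD addrACA -scalerBr.
have := hnormD (a *: (x - u)) (y - v); have := hC (x - u).
move: xu; rewrite ltr_pdivlMr// mulrC.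
lra.
Qed.

(** * Orthogonal projection onto a closed subspace *)

Lemma invn_lt r : 0 < r -> exists N, forall n, (N <= n)%N -> n.+1%:R^-1 < r.
Proof.
move=> r0; exists (Num.bound r^-1) => n hn.
rewrite -[r]invrK ltf_pV2 ?posrE ?invr_gt0 ?ltr0Sn//.
apply: lt_le_trans (archi_boundP _) _; first by rewrite invr_ge0 ltW.
by rewrite ler_nat ltnW.
Qed.

(** The parallelogram law for [x - y] and [x - z], arranged to show the midpoint of [y] and [z]:
    when these lie in a subspace, so does the midpoint, and its distance to [x] is at least the
    infimum. *)
Lemma parallelogram x y z :
  hn (y - z) ^+ 2 =
  2 * hn (x - y) ^+ 2 + 2 * hn (x - z) ^+ 2 - 4 * hn (x - 2^-1 *r (y + z)) ^+ 2.
Proof.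
rewrite !hnorm_sqr !ripE (ripC z y) (ripC y x) (ripC z x); by field.
Qed.

(** A minimizing sequence is Cauchy by the parallelogram law; its limit exists by completeness and
    stays in [M] by closedness. *)
Lemma closest_point M x : subspace M -> hclosure ip M `<=` M ->
  exists2 p, M p & forall m, M m -> hn (x - p) <= hn (x - m).
Proof.
move=> sM cM; pose D := [set hn (x - m) | m in M].
have lD : has_lbound D by exists 0 => _ [m _ <-]; exact: hnorm_ge0.
have D0 : D !=set0 by exists (hn (x - 0)); exists 0 => //; case: sM.
have dP m : M m -> inf D <= hn (x - m) by move=> Mm; apply: ge_inf => //; exists m.
have d0 : 0 <= inf D by apply: lb_le_inf => // _ [m _ <-]; exact: hnorm_ge0.
have : forall n : nat, exists m, M m /\ hn (x - m) < inf D + n.+1%:R^-1.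
  move=> n; have n0 : (0 : R) < n.+1%:R^-1 by rewrite invr_gt0 ltr0Sn.
  by have [_ [m Mm <-] h] := inf_adherent n0 (conj D0 lD); exists m.
move=> /choice[u hu]; move: (inf D) d0 dP hu => d d0 dP hu.
have cu : cauchy_seq ip u.
  (* The parallelogram law will bound [|u m - u n|^2] by [4 (d + e1)^2 - 4 d^2], which is at most
     [(8 d + 4) e1] as [e1 < 1]. The extra [e ^+ 2] in the denominator gives both [e1 < 1] and
     strictness. *)
  move=> e e0; set e1 := e ^+ 2 / (8 * d + 4 + e ^+ 2).
  have den : 0 < 8 * d + 4 + e ^+ 2 by have := exprn_gt0 2 e0; lra.
  have e10 : 0 < e1 by rewrite divr_gt0// exprn_gt0.
  have e11 : e1 < 1 by rewrite ltr_pdivrMr// mul1r; lra.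
  have e1E : e1 * (8 * d + 4 + e ^+ 2) = e ^+ 2 by rewrite mulfVK ?gt_eqF.
  have [N hN] := invn_lt e10; exists N => m n Nm Nn.
  rewrite -ltr_sqr ?nnegrE ?hnorm_ge0 ?ltW// (parallelogram x).
  have sq k : (N <= k)%N -> hn (x - u k) ^+ 2 <= (d + e1) ^+ 2.
    move=> Nk; rewrite ler_sqr ?nnegrE ?hnorm_ge0 ?addr_ge0 ?(ltW e10)//.
    have [_ /ltW/le_trans->//] := hu k; by rewrite lerD2l ltW// hN.
  have : d ^+ 2 <= hn (x - 2^-1 *r (u m + u n)) ^+ 2.
    rewrite ler_sqr ?nnegrE ?hnorm_ge0//; apply: dP.
    by apply: subspaceZ => //; apply: subspaceD => //; [case: (hu m)|case: (hu n)].
  have := sq m Nm; have := sq n Nn.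
  have : 0 < e1 * e ^+ 2 by rewrite mulr_gt0// exprn_gt0.
  have : e1 ^+ 2 <= e1 by rewrite expr2 ger_pMr// ltW.
  nra.
have [p hp] : converges ip u by case: hH => _ _ _ _; apply.
exists p.
  by apply: cM => e e0; have [N hN] := hp e e0; exists (u N);
    [case: (hu N)|rewrite hnormBC; exact: hN].
move=> m Mm; apply: le_trans (dP m Mm).
apply/ler_addgt0Pr => e e0; have e2 : 0 < e / 2 by lra.
have [N hN] := hp _ e2; have [N' hN'] := invn_lt e2.
move: (hN _ (leq_maxl N N')) (hN' _ (leq_maxr N N')) (hu (maxn N N')).
move: (maxn N N') => n h1 h2 [_ h3]; have := hnormB_triangle (u n) x p.
move: (n.+1%:R^-1) h2 h3 => r; lra.
Qed.

(** Moving the closest point [p] along [m] by any real [t] cannot decrease the distance to [x],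
    which forces the linear term in [t] to vanish. *)
Lemma orthogonal_projection M x : subspace M -> hclosure ip M `<=` M ->
  exists p, M p /\ forall m, M m -> ip (x - p) m = 0.
Proof.
move=> sM cM; have [p Mp hp] := closest_point x sM cM; exists p; split => //.
have orth m : M m -> rip (x - p) m = 0.
  move=> Mm; set b := rip (x - p) m.
  have key t : 0 <= t ^+ 2 * rip m m - 2 * t * b.
    have := hp (p + t *r m) (subspaceD sM Mp (subspaceZ _ sM Mm)).
    rewrite -ler_sqr ?nnegrE ?hnorm_ge0// !hnorm_sqr opprD addrA.
    move: (x - p) @b => z; rewrite !ripE (ripC m z) /=; lra.
  (* The minimizer would be [b / rip m m]; adding 1 also covers [m = 0] and still makes the
     quadratic negative unless [b = 0]. *)
  have := key (b / (rip m m + 1)); have r1 : 0 < rip m m + 1 by rewrite ltr_wpDl ?rip_ge0.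
  have -> : (b / (rip m m + 1)) ^+ 2 * rip m m - 2 * (b / (rip m m + 1)) * b
     = - ((b / (rip m m + 1)) ^+ 2 * (rip m m + 2)) by field; rewrite gt_eqF.
  rewrite oppr_ge0 => h.
  have : (b / (rip m m + 1)) ^+ 2 * (rip m m + 2) == 0.
    by rewrite eq_le h mulr_ge0 ?sqr_ge0 ?addr_ge0 ?rip_ge0.
  have r2 : 0 < rip m m + 2 by rewrite ltr_wpDl ?rip_ge0.
  rewrite mulf_eq0 expf_eq0 /= mulf_eq0 invr_eq0 (gt_eqF r1) (gt_eqF r2) !orbF.
  by move=> /eqP.
(* [Re (ip z ('i m))] is the imaginary part of [ip z m]. *)
move=> m Mm; have := orth m Mm; have := orth _ (subspaceZ 'i%C sM Mm).
rewrite /rip [ip _ (_ *: _)]ipC ipZl [ip m _]ipC rmorphM /= conjCK.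
case: (ip _ m) => a b /=; rewrite ?mul0r ?oppr0 ?sub0r ?mulN1r ?opprK ?add0r.
by move=> + ->; move=> h; congr (Complex _ _); lra.
Qed.

Lemma range_proj_exists M : subspace M -> hclosure ip M `<=` M ->
  exists P, is_projection ip P /\ range P = M.
Proof.
move=> sM cM.
have [P hP] := choice (fun x => orthogonal_projection x sM cM).
have MP x : M (P x) by case: (hP x).
have orth x m : M m -> ip (x - P x) m = 0 by case: (hP x) => _; apply.
(* Uniqueness of the foot: [P x - p] lies in [M] and is the difference of two vectors orthogonal to
   [M]. Linearity and idempotence of [P] follow from it. *)
have Pu x p : M p -> (forall m, M m -> ip (x - p) m = 0) -> P x = p.
  move=> Mp h; apply/eqP; rewrite -subr_eq0; apply/eqP; apply: rip_eq0.
  have Md := subspaceB sM (MP x) Mp.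
  have -> : rip (P x - p) (P x - p)
      = rip (x - p) (P x - p) - rip (x - P x) (P x - p) by rewrite !ripE; ring.
  by rewrite /rip h// orth// subrr.
have Pid m : M m -> P m = m.
  by move=> Mm; apply: Pu => // k _; rewrite subrr ip0l.
have ipP x y : ip (P x) (P y) = ip x (P y).
  by apply/eqP; rewrite eq_sym -subr_eq0 -ipBl orth.
have PP x y : ip (P x) y = ip x (P y).
  by rewrite -[RHS]ipP [LHS]ipC -ipP -[LHS]ipC.
exists P; split; last first.
  by apply/seteqP; split=> [_ [x _ <-] //|m Mm]; exists m => //; exact: Pid.
split=> //; last by move=> x; exact: Pid.
split.
  move=> a x y; apply: Pu; first by case: sM => _; apply.
  move=> m Mm; rewrite opprD addrACA -scalerBr ip_linear !orth//.
  by rewrite mulr0 addr0.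
exists 1 => x; rewrite mul1r.
have := cauchy_schwarz x (P x); rewrite /rip -ipP -/(rip _ _) -hnorm_sqr expr2.
have [->|h] := eqVneq (hn (P x)) 0; first by rewrite hnorm_ge0.
by rewrite ler_pM2r// lt_def h hnorm_ge0.
Qed.

(** The closure of the range is a closed subspace, so the description that defines [rproj] is
    satisfiable. *)
Lemma rprojP S : is_linear_op S -> is_range_proj ip S (rproj ip S).
Proof.
move=> lS; apply: ClassicalEpsilon.epsilon_spec.
by apply: range_proj_exists;
  [apply: hclosure_subspace; exact: range_subspace|exact: hclosureK].
Qed.

(** * Projections, and closed ranges of operators bounded below *)

Lemma proj_range P x : is_projection ip P -> range P x -> P x = x.
Proof. by case=> _ PP _ [y _ <-]. Qed.

Lemma proj_rip P x y : is_projection ip P -> rip (P x) y = rip x (P y).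
Proof. by case=> _ _ h; rewrite /rip h. Qed.

Lemma proj_hnorm P x : is_projection ip P -> hn (P x) ^+ 2 = rip x (P x).
Proof. by move=> pP; rewrite hnorm_sqr proj_rip//; case: pP => _ ->. Qed.

Lemma proj_le P x : is_projection ip P -> hn (P x) <= hn x.
Proof.
move=> pP; have := cauchy_schwarz x (P x); rewrite -proj_hnorm// expr2.
have [->|h] := eqVneq (hn (P x)) 0; first by rewrite hnorm_ge0.
by rewrite ler_pM2r// lt_def h hnorm_ge0.
Qed.

Lemma proj_compl E : is_projection ip E -> is_projection ip (fun x => x - E x).
Proof.
move=> pE; case: (pE) => -[lE _] EE sE; split.
- split; first by move=> a x y; rewrite lE opprD addrACA scalerBr.
  exists 2 => x; have := hnormD x (- E x); rewrite hnormN.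
  by have := proj_le x pE; lra.
- by move=> x; rewrite linearB// EE subrr subr0.
- by move=> x y; rewrite ipBl ipBr sE.
Qed.

Lemma pythagoras E x y : is_projection ip E -> E x = x -> E y = 0 ->
  hn (x + y) ^+ 2 = hn x ^+ 2 + hn y ^+ 2.
Proof.
move=> pE Ex Ey; have xy : rip x y = 0.
  by rewrite -Ex proj_rip// Ey ripC /rip ip0l.
by rewrite !hnorm_sqr !ripE (ripC y) xy; ring.
Qed.

(* The preimages of a convergent sequence of values form a Cauchy sequence. *)
Lemma range_closed T E r : bounded_op ip T -> is_projection ip E -> 0 < r ->
  (forall x, r * hn (E x) <= hn (T (E x))) ->
  hclosure ip (range (fun x => T (E x))) `<=` range (fun x => T (E x)).
Proof.
move=> bT pE r0 hr y hy; have [lT _] := bT; case: (pE) => -[lE _] EE _.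
have : forall n : nat, exists x, hn (y - T (E x)) < n.+1%:R^-1.
  move=> n; have n0 : (0 : R) < n.+1%:R^-1 by rewrite invr_gt0 ltr0Sn.
  by have [_ [x _ <-] h] := hy _ n0; exists x.
move=> /choice[u hu].
have cu : cauchy_seq ip (fun n => E (u n)).
  move=> e e0; have e1 : 0 < r * e / 2 by rewrite divr_gt0 ?mulr_gt0.
  have [N hN] := invn_lt e1; exists N => m n Nm Nn.
  have := hr (u m - u n); rewrite linearB// linearB//.
  have := hnormB_triangle y (T (E (u m))) (T (E (u n))).
  rewrite (hnormBC _ y) -(ltr_pM2l r0).
  by move: (m.+1%:R^-1) (n.+1%:R^-1) (hu m) (hu n) (hN m Nm) (hN n Nn) => i j; lra.
have [l hl] : converges ip (fun n => E (u n)) by case: hH => _ _ _ _; apply.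
exists l => //; have [C C0 hC] := bounded_opP bT.
apply/eqP; rewrite -subr_eq0; apply/eqP; apply: hnorm_eq0.
apply: small_eq0 => [|e e0]; first exact: hnorm_ge0.
have [N hN] := hl (e / 2 / C) ltac:(by rewrite !divr_gt0).
have [N' hN'] := invn_lt (ltac:(by rewrite divr_gt0) : 0 < e / 2).
move: (hN _ (leq_maxl N N')) (hN' _ (leq_maxr N N')) (hu (maxn N N')).
move: (maxn N N') => n; rewrite (hnormBC _ l) (ltr_pdivlMr _ _ C0) => h1 h2 h3.
(* Nothing is shown about [E l = l]; comparing [E l] with [E (u n)] suffices, since [E] is a
   contraction fixing [E (u n)]. *)
have h4 := hC (E (l - E (u n))); rewrite linearB// EE linearB// in h4.
have h5 := proj_le (l - E (u n)) pE; rewrite linearB// EE -(ler_pM2l C0) in h5.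
have := hnormB_triangle (T (E (u n))) (T (E l)) y.
rewrite (hnormBC (T (E (u n))) y); move: (n.+1%:R^-1) h1 h2 h3 => i /= h1 h2 h3; lra.
Qed.

(** With the closure gone, every vector in the range of the projection has an actual preimage, to
    which the lower bound on [T] applies. *)
Lemma rproj_range T E r : bounded_op ip T -> is_projection ip E -> 0 < r ->
  (forall x, r * hn (E x) <= hn (T (E x))) ->
  is_projection ip (rproj ip (fun x => T (E x))) /\
  range (rproj ip (fun x => T (E x))) = range (fun x => T (E x)).
Proof.
move=> bT pE r0 hr; have [lT _] := bT; case: (pE) => -[lE _] _ _.
have lTE : is_linear_op (fun x => T (E x)) by move=> a x y; rewrite lE lT.
have [pP rP] := rprojP lTE; split => //; rewrite rP; apply/seteqP.
by split; [exact: range_closed hr|exact: sub_hclosure].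
Qed.

(** * Operator norms *)

Lemma bounded_onZ K S r x : subspace K -> bounded_on ip K S -> K x ->
  S (r *r x) = r *r S x.
Proof.
move=> [K0 _] [lS _] Kx; have S0 : S 0 = 0.
  by have := lS (-1) 0 0 K0 K0; rewrite scaler0 addr0 scaleN1r addNr.
by rewrite -[r *r x]addr0 lS// S0 addr0.
Qed.

(** A nonzero [x] is rescaled to norm 1. Boundedness of [S] is what makes [sup] an upper bound of
    the values. *)
Lemma le_opnorm_on K S x : subspace K -> bounded_on ip K S -> K x ->
  hn (S x) <= opnorm_on ip K S * hn x.
Proof.
move=> sK bS Kx; have [x0|x0] := eqVneq (hn x) 0.
  have SZ := bounded_onZ 0 sK bS Kx.
  by move: SZ; rewrite (hnorm_eq0 x0) !scale0r => ->; rewrite hnorm0 mulr0.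
have xp : 0 < hn x by rewrite lt_def x0 hnorm_ge0.
rewrite -ler_pdivrMr// mulrC -[X in X * _]gtr0_norm ?invr_gt0// -hnormZ.
rewrite -(bounded_onZ _ sK bS Kx); apply: ub_le_sup.
  case: bS => _ [C hC]; exists `|C| => _ [y [Ky y1] <-].
  apply: le_trans (hC y Ky) _; apply: le_trans (ler_norm _) _.
  by rewrite normrM (ger0_norm (hnorm_ge0 y)) ler_piMr.
exists ((hn x)^-1 *r x) => //; split; first exact: subspaceZ.
by rewrite hnormZ gtr0_norm ?invr_gt0// mulVf.
Qed.

Lemma opnorm_on_le K S r : subspace K ->
  (forall y, K y -> hn y <= 1 -> hn (S y) <= r) -> opnorm_on ip K S <= r.
Proof.
move=> [K0 _] h; apply: ge_sup; last by move=> _ [y [Ky y1] <-]; exact: h.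
by exists (hn (S 0)); exists 0 => //=; rewrite hnorm0 ler01.
Qed.

Lemma opnorm_on_ge0 K S : subspace K -> bounded_on ip K S -> 0 <= opnorm_on ip K S.
Proof.
move=> sK [_ [C hC]]; apply: le_trans (hnorm_ge0 (S 0)) _; apply: ub_le_sup.
  exists `|C| => _ [y [Ky y1] <-].
  apply: le_trans (hC y Ky) _; apply: le_trans (ler_norm _) _.
  by rewrite normrM (ger0_norm (hnorm_ge0 y)) ler_piMr.
by exists 0 => //=; split; [case: sK|rewrite hnorm0 ler01].
Qed.

Lemma opnorm_onT S : opnorm ip S = opnorm_on ip setT S.
Proof.
congr sup; apply/seteqP; split=> _ [y h <-]; exists y => //.
by case: h.
Qed.

Lemma bounded_op_onT S : bounded_op ip S -> bounded_on ip setT S.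
Proof. by move=> [lS [C hC]]; split => [a x y _ _|]; [exact: lS|exists C]. Qed.

Lemma le_opnorm S x : bounded_op ip S -> hn (S x) <= opnorm ip S * hn x.
Proof.
by move=> bS; rewrite opnorm_onT; apply: le_opnorm_on => //; exact: bounded_op_onT.
Qed.

Lemma opnorm_le S r : (forall x, hn x <= 1 -> hn (S x) <= r) -> opnorm ip S <= r.
Proof. by move=> h; rewrite opnorm_onT; apply: opnorm_on_le => // y _; exact: h. Qed.

Lemma opnorm_ge0 S : bounded_op ip S -> 0 <= opnorm ip S.
Proof.
by move=> bS; rewrite opnorm_onT; apply: opnorm_on_ge0 => //; exact: bounded_op_onT.
Qed.

Lemma proj_comp_bounded P (Q : V -> V) : is_projection ip P -> is_projection ip Q ->
  bounded_op ip (P \o Q).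
Proof.
move=> pP pQ; case: (pP) (pQ) => -[lP _] _ _ [[lQ _] _ _].
split; first by move=> a x y /=; rewrite lQ lP.
by exists 1 => x; rewrite mul1r (le_trans (proj_le _ pP))// proj_le.
Qed.

(** * The angle between the ranges of [TE] and [T(I - E)] *)

Section Angle.
Variables (T E P Q : V -> V).
Hypotheses (bT : bounded_op ip T) (pE : is_projection ip E).
Hypotheses (pP : is_projection ip P) (pQ : is_projection ip Q).
Hypothesis rP : range P = range (fun x => T (E x)).
Hypothesis rQ : range Q = range (fun x => T (x - E x)).

(* With [n = Q x] and [m = P n], apply the bound on [T^-1] to the difference
   of [n] and of the multiple of [m] that has the same norm as [n]. *)
Lemma opnorm_comp_le (L : R) : (forall x, hn x <= L * hn (T x)) ->
  0 <= L -> 1 <= opnorm ip T * L ->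
  opnorm ip (P \o Q) <= 1 - ((opnorm ip T * L) ^+ 2)^-1.
Proof.
move=> hL L0; set t := opnorm ip T => tL; apply: opnorm_le => x x1 /=.
have tL0 : 0 < (t * L) ^+ 2 by rewrite exprn_gt0// (lt_le_trans ltr01).
have q0 : ((t * L) ^+ 2)^-1 <= 1 by rewrite invf_le1// -[1](expr1n _ 2) ler_sqr ?nnegrE// (le_trans ler01).
have [lT _] := bT; have [[lE _] EE _] := pE.
set n := Q x; set m := P n.
have n1 : hn n <= 1 by apply: le_trans (proj_le x pQ) x1.
(* For [m = 0] no rescaling is possible, but [q0] makes the right-hand side nonnegative. *)
have [m0|m0] := eqVneq (hn m) 0; first by rewrite m0 subr_ge0.
have mp : 0 < hn m by rewrite lt_def m0 hnorm_ge0.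
have mn : hn m <= hn n by exact: proj_le.
have np : 0 < hn n by exact: lt_le_trans mn.
have [u _ mE] : range (fun x => T (E x)) m by rewrite -rP; exists n.
have [v _ nE] : range (fun x => T (x - E x)) n by rewrite -rQ; exists x.
have [al al0 alm] : exists2 al : R, 0 < al & al * hn m = hn n.
  by exists (hn n / hn m); rewrite ?divfK ?divr_gt0.
have e1 : E (al *r E u) = al *r E u by rewrite linearZ// EE.
have e2 : E (- (v - E v)) = 0 by rewrite opprB linearB// EE subrr.
have py := pythagoras pE e1 e2; rewrite hnormN hnormZ gtr0_norm// in py.
have mmn : rip m n = hn m ^+ 2 by rewrite proj_hnorm// ripC.
have sqr_le (p q : R) : 0 <= p -> p <= q -> p ^+ 2 <= q ^+ 2.
  by move=> p0 pq; rewrite ler_sqr ?nnegrE ?(le_trans p0).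
have key := sqr_le _ _ (hnorm_ge0 _) (hL (al *r E u - (v - E v))).
rewrite (linearB _ _ lT) (linearZ _ _ lT) mE nE py !exprMn (hnorm_sqr (_ - n)) in key.
rewrite !ripE (ripC n) mmn -!hnorm_sqr in key.
have hu : al * hn m <= t * (al * hn (E u)).
  by rewrite mulrCA ler_pM2l// -mE le_opnorm.
have hv : hn n <= t * hn (v - E v) by rewrite -nE le_opnorm.
rewrite alm in hu; have hu2 := sqr_le _ _ (ltW np) hu.
have hv2 := sqr_le _ _ (ltW np) hv; rewrite !exprMn in hu2 hv2.
(* Multiply [key] by [t ^+ 2]: by [hu2] and [hv2] each of the two squares on the left becomes at
   least [hn n ^+ 2]. *)
have key2 : 2 * hn n ^+ 2 <= (t * L) ^+ 2 * (2 * hn n ^+ 2 - 2 * hn n * hn m).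
  have := ler_wpM2l (sqr_ge0 t) key.
  have -> : al * (al * hn m ^+ 2 - hn m ^+ 2) - (al * hn m ^+ 2 - hn n ^+ 2)
    = 2 * hn n ^+ 2 - 2 * hn n * hn m by rewrite -alm; ring.
  by rewrite exprMn; lra.
have key3 : hn n <= (t * L) ^+ 2 * (hn n - hn m).
  have n2 : 0 < 2 * hn n by lra.
  by rewrite -(ler_pM2l n2); lra.
have key4 : hn m <= (1 - ((t * L) ^+ 2)^-1) * hn n.
  rewrite -(ler_pM2l tL0) mulrA mulrBr mulr1 mulfV ?gt_eqF//; lra.
by apply: le_trans key4 _; rewrite ler_piMr// subr_ge0.
Qed.

Lemma angle_lower_bound (r : R) x : 0 <= r ->
  r * hn (E x) <= hn (T (E x)) -> r * hn (x - E x) <= hn (T (x - E x)) ->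
  (1 - opnorm ip (P \o Q)) * (r * hn x) ^+ 2 <= hn (T x) ^+ 2.
Proof.
move=> r0; have bPQ := proj_comp_bounded pP pQ.
set s := opnorm ip (P \o Q) => h1 h2.
have s0 : 0 <= s by exact: opnorm_ge0.
have s1 : s <= 1.
  by apply: opnorm_le => y y1 /=; rewrite (le_trans (proj_le _ pP))// (le_trans (proj_le _ pQ)).
have [lT _] := bT; have [[lE _] EE _] := pE.
have := @pythagoras E (E x) (x - E x) pE (EE x).
rewrite linearB// EE subrr => /(_ erefl); rewrite [E x + _]addrC subrK => xE.
have TxE : T x = T (E x) + T (x - E x) by rewrite -linearD// [E x + _]addrC subrK.
move: h1 h2.
have Pu : P (T (E x)) = T (E x) by apply: proj_range => //; rewrite rP; exists x.
have Qv : Q (T (x - E x)) = T (x - E x).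
  by apply: proj_range => //; rewrite rQ; exists x.
(* As [P] fixes [T (E x)] and [Q] fixes [T (x - E x)], the pairing equals that of [T (E x)] with
   [P (Q (T (x - E x)))]. *)
have uv : - rip (T (E x)) (T (x - E x)) <= s * (hn (T (E x)) * hn (T (x - E x))).
  rewrite -{1}Pu proj_rip// -{1}Qv -ripNl.
  apply: le_trans (cauchy_schwarz _ _) _.
  by rewrite hnormN mulrCA ler_wpM2l ?hnorm_ge0// (le_opnorm _ bPQ).
rewrite exprMn xE {Pu Qv xE} TxE [X in _ -> _ -> _ <= X]hnorm_sqr !ripE.
rewrite (ripC (T (x - E x))) -!hnorm_sqr.
move: uv; move: (rip _ _) (hn (T (E x))) (hn (T (x - E x))) (hnorm_ge0 (T (E x))) (hnorm_ge0 (T (x - E x))).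
move=> c u v u0 v0 uv.
rewrite -ler_sqr ?nnegrE ?mulr_ge0 ?hnorm_ge0// exprMn => h1.
rewrite -ler_sqr ?nnegrE ?mulr_ge0 ?hnorm_ge0// exprMn => h2.
apply: (@le_trans _ _ ((1 - s) * (u ^+ 2 + v ^+ 2))).
  by rewrite ler_wpM2l ?subr_ge0// mulrDr lerD.
(* This absorbs the cross term: [2 s u v <= s (u^2 + v^2)]. *)
have : 0 <= s * (u - v) ^+ 2 by rewrite mulr_ge0 ?sqr_ge0.
by move: uv; lra.
Qed.

End Angle.

(** * The range space, the equivalence and the norm bounds *)

Lemma bounded_onP K S : bounded_on ip K S ->
  exists2 C : R, 0 < C & forall x, K x -> hn (S x) <= C * hn x.
Proof.
case=> _ [C hC]; exists (`|C| + 1); first by rewrite ltr_wpDl.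
move=> x Kx; apply: le_trans (hC x Kx) _; rewrite ler_wpM2r ?hnorm_ge0//.
by rewrite ler_wpDr// ler_norm.
Qed.

Lemma rspace_subspace S : is_linear_op S -> subspace (rspace ip S).
Proof. by move=> lS; have [[[lP _] _ _] _] := rprojP lS; exact: range_subspace. Qed.

Lemma rspaceE S : is_linear_op S -> rspace ip S = hclosure ip (range S).
Proof. by move=> lS; have [_] := rprojP lS. Qed.

Lemma rspace_app S x : is_linear_op S -> rspace ip S (S x).
Proof. by move=> lS; rewrite rspaceE//; apply: sub_hclosure; exists x. Qed.

Lemma rproj_id S y : is_linear_op S -> rspace ip S y -> rproj ip S y = y.
Proof. by move=> lS Ky; have [pP _] := rprojP lS; exact: proj_range. Qed.

(** Needed for [T(I - E)] when [E] is the identity. *)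
Lemma rproj_zero S y : (forall x, S x = 0) -> rproj ip S y = 0.
Proof.
move=> S0; have lS : is_linear_op S by move=> a x z; rewrite !S0 scaler0 addr0.
have : rspace ip S (rproj ip S y) by exists y.
rewrite rspaceE// => h; apply: hnorm_eq0; apply: small_eq0 => [|e e0].
  exact: hnorm_ge0.
by have [_ [x _ <-]] := h e e0; rewrite S0 subr0.
Qed.

Lemma is_projection_id : is_projection ip id.
Proof. by split => //; split => //; exists 1 => x; rewrite mul1r. Qed.

Lemma invertible_cond (T : V -> V) : bounded_op ip T ->
  invertible_onto ip (rspace ip T) T ->
  exists E, [/\ is_projection ip E,
    exists a1 a2 : R, [/\ 0 < a1, 0 < a2,
        (forall x, a1 * hn (E x) <= hn (T (E x)))
      & (forall x, a2 * hn (x - E x) <= hn (T (x - E x)))]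
    & invertible_in ip (rspace ip T) (fun y => rproj ip (T \o E) y
        - rproj ip (fun x => T (x - E x)) y)].
Proof.
move=> [lT _] [KT [Tinv [TiT _ bTi]]]; exists id; split.
- exact: is_projection_id.
(* A bound [C] on the inverse makes [T] bounded below by [C^-1]; the second constant is arbitrary,
   both sides being 0. *)
- have [C C0 hC] := bounded_onP bTi; exists C^-1, 1; split => // [|x|x].
  + by rewrite invr_gt0.
  + by rewrite ler_pdivrMl// -{1}[x]TiT hC.
  + by rewrite subrr hnorm0 mulr0 hnorm_ge0.
have AE y : rspace ip T y ->
    rproj ip (T \o id) y - rproj ip (fun x => T (x - id x)) y = y.
  move=> Ky; have T0 x : T (x - id x) = 0 by rewrite subrr linear0.
  by rewrite (rproj_zero y T0) subr0; exact: (rproj_id lT Ky).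
split=> [y Ky|]; first by rewrite AE.
exists id; split => //.
by split => //; exists 1 => y _; rewrite mul1r.
Qed.

(* Writing [y = (P - Q) z] decomposes [y] as a difference of an element of the
   range of [TE] and one of the range of [T(I - E)], with control of the norms;
   a vector in both ranges is killed by [P - Q], which makes [T] injective. *)
Lemma cond_invertible (T E : V -> V) (a1 a2 : R) : bounded_op ip T ->
  is_projection ip E -> 0 < a1 -> 0 < a2 ->
  (forall x, a1 * hn (E x) <= hn (T (E x))) ->
  (forall x, a2 * hn (x - E x) <= hn (T (x - E x))) ->
  invertible_in ip (rspace ip T) (fun y => rproj ip (T \o E) y
    - rproj ip (fun x => T (x - E x)) y) ->
  invertible_onto ip (rspace ip T) T.
Proof.
move=> bT pE a10 a20 h1 h2.
have [pP rP] := rproj_range bT pE a10 h1.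
have [pQ rQ] := rproj_range bT (proj_compl pE) a20 h2.
have [lT _] := bT; have [[lE _] EE _] := pE.
move: pP rP pQ rQ; rewrite -/(T \o E); set P := rproj _ _; set Q := rproj _ _.
move=> pP rP pQ rQ [_ [B [BK AB BA bB]]].
have sK := rspace_subspace lT; have KT x := rspace_app x lT.
have BA0 y : rspace ip T y -> P y = y -> Q y = y -> y = 0.
  move=> Ky Py Qy; rewrite -(BA y Ky) Py Qy subrr.
  by have := bounded_onZ 0 sK bB Ky; rewrite !scale0r.
have T0 x : T x = 0 -> x = 0.
  move=> Tx0.
  (* From [T x = 0], the vector [T (E x)] equals [- T (x - E x)] and so lies in both ranges. *)
  have TE : T (E x) = T ((- x) - E (- x)).
    rewrite -scaleN1r linearZ// -scalerBr linearZ// linearB// Tx0 sub0r.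
    by rewrite scaleN1r opprK.
  have TE0 : T (E x) = 0.
    apply: BA0 => //; apply: proj_range => //; [rewrite rP; by exists x|].
    by rewrite rQ; exists (- x).
  have Ex : E x = 0.
    apply: hnorm_eq0; apply/eqP; rewrite eq_le hnorm_ge0 andbT.
    by rewrite -(pmulr_rle0 _ a10) -(hnorm0) -TE0.
  have := h2 x; rewrite Ex subr0 Tx0 hnorm0 pmulr_rle0// => x0.
  by apply: hnorm_eq0; apply/eqP; rewrite eq_le x0 hnorm_ge0.
have Tinj x y : T x = T y -> x = y.
  move=> /eqP; rewrite -subr_eq0 -linearB// => /eqP /T0 /eqP.
  by rewrite subr_eq0 => /eqP.
have [C C0 hC] := bounded_onP bB.
(* Stated for all [y], with 0 as default outside the range space, so that [choice] yields a total
   function. Each summand is the bound on [B] divided by a lower bound on [T]. *)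
have pre y : exists x, rspace ip T y -> T x = y /\ hn x <= (C / a1 + C / a2) * hn y.
  have [Ky|nK] := pselect (rspace ip T y); last by exists 0.
  have [u _ uE] : range (fun x => T (E x)) (P (B y)) by rewrite -rP; exists (B y).
  have [v _ vE] : range (fun x => T (x - E x)) (Q (B y)) by rewrite -rQ; exists (B y).
  exists (E u - (v - E v)) => _; split; first by rewrite linearB// uE vE AB.
  have hB := hC y Ky; rewrite mulrDl.
  apply: le_trans (hnormD _ _) _; rewrite hnormN; apply: lerD.
    rewrite mulrAC ler_pdivlMr// mulrC; apply: le_trans (h1 u) _.
    by rewrite uE (le_trans (proj_le _ pP)).
  rewrite mulrAC ler_pdivlMr// mulrC; apply: le_trans (h2 v) _.
  by rewrite vE (le_trans (proj_le _ pQ)).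
have [Ti hTi] := choice pre; split => //; exists Ti; split.
- by move=> x; apply: Tinj; case: (hTi _ (KT x)).
- by move=> y /hTi[].
split; last by exists (C / a1 + C / a2) => y /hTi[].
(* The preimages were merely chosen; injectivity of [T] makes the choice linear. *)
move=> a x y Kx Ky; apply: Tinj; rewrite lT.
have [-> _] := hTi x Kx; have [-> _] := hTi y Ky.
by have [-> _] := hTi _ (proj2 sK a x y Kx Ky).
Qed.

Lemma inverse_norm_bounds (T E Tinv : V -> V) (a1 a2 : R) : bounded_op ip T ->
  is_projection ip E -> 0 < a1 -> 0 < a2 ->
  (forall x, a1 * hn (E x) <= hn (T (E x))) ->
  (forall x, a2 * hn (x - E x) <= hn (T (x - E x))) ->
  is_inverse_onto ip (rspace ip T) T Tinv ->
  let c := Num.sqrt (1 - opnorm ip (rproj ip (T \o E)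
                         \o rproj ip (fun x => T (x - E x))))
           * opnorm_on ip (rspace ip T) Tinv in
  (opnorm ip T)^-1 <= c /\ c <= (Num.min a1 a2)^-1.
Proof.
move=> bT pE a10 a20 h1 h2 [TiT TTi bTi].
have [pP rP] := rproj_range bT pE a10 h1.
have [pQ rQ] := rproj_range bT (proj_compl pE) a20 h2.
have [lT _] := bT; move: pP rP pQ rQ; rewrite -/(T \o E).
set P := rproj _ _; set Q := rproj _ _; set s := opnorm _ (_ \o _).
set L := opnorm_on _ _ _; move=> pP rP pQ rQ c.
have sK := rspace_subspace lT; have KT x := rspace_app x lT.
have L0 : 0 <= L by exact: opnorm_on_ge0.
have hL x : hn x <= L * hn (T x) by rewrite -{1}[x]TiT le_opnorm_on.
have c0 : 0 <= c by rewrite mulr_ge0 ?sqrtr_ge0.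
split.
  (* If [T] has norm 0, its inverse is 0 by convention and the claim is [c0]. *)
  have [t0|t0] := eqVneq (opnorm ip T) 0; first by rewrite t0 invr0.
  have tp : 0 < opnorm ip T by rewrite lt_def t0 opnorm_ge0.
  have [x xp] : exists x, 0 < hn x.
    apply: contrapT => nx; suff : opnorm ip T <= 0 by rewrite leNgt tp.
    apply: opnorm_le => x _; apply: le_trans (le_opnorm x bT) _.
    rewrite pmulr_rle0// leNgt; apply/negP => xp; by apply: nx; exists x.
  have tL : 1 <= opnorm ip T * L.
    rewrite -(ler_pM2r xp) mul1r; apply: le_trans (hL x) _.
    by rewrite -mulrA mulrCA ler_wpM2l// le_opnorm.
  have tL0 := lt_le_trans ltr01 tL.
  have sle := opnorm_comp_le bT pE pP pQ rP rQ hL L0 tL.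
  have : (opnorm ip T * L)^-1 <= Num.sqrt (1 - s).
    have tLV : 0 <= (opnorm ip T * L)^-1 by rewrite invr_ge0 ltW.
    by rewrite -(ger0_norm tLV) -sqrtr_sqr ler_wsqrtr// exprVn lerBrDl -lerBrDr.
  move=> /(ler_wpM2r L0); apply: le_trans.
  by rewrite invfM -mulrA mulVf ?mulr1// gt_eqF// -(pmulr_rgt0 _ tp).
set a := Num.min a1 a2.
have ap : 0 < a by rewrite lt_min a10.
(* A vanishing root makes [c] zero; otherwise it can be divided out, leaving a bound on
   [hn (Tinv y)], to which [angle_lower_bound] applies with [a] as common constant. *)
have [w0|w0] := eqVneq (Num.sqrt (1 - s)) 0.
  by rewrite /c w0 mul0r invr_ge0 ltW.
have wp : 0 < Num.sqrt (1 - s) by rewrite lt_def w0 sqrtr_ge0.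
have s1 : 0 < 1 - s by rewrite -sqrtr_gt0.
rewrite /c mulrC -ler_pdivlMr// -invfM.
apply: opnorm_on_le => // y Ky y1.
rewrite -[_^-1]mulr1 ler_pdivlMl ?mulr_gt0//; apply: le_trans y1.
rewrite -{2}(TTi y Ky) -ler_sqr ?nnegrE ?hnorm_ge0//; last first.
  by rewrite mulr_ge0 ?hnorm_ge0 ?mulr_ge0 ?ltW.
rewrite [a * _]mulrC -mulrA exprMn sqr_sqrtr ?(ltW s1)//.
apply: (angle_lower_bound bT pE pP pQ rP rQ (ltW ap)).
  by apply: le_trans (h1 _); rewrite ler_wpM2r ?hnorm_ge0// ge_min lexx.
by apply: le_trans (h2 _); rewrite ler_wpM2r ?hnorm_ge0// ge_min lexx orbT.
Qed.

End HilbertSpace.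

Theorem theorem3p9 (R : realType) (V : lmodType R[i]) (ip : V -> V -> R[i])
  (hH : is_hilbert ip) (T : V -> V) (hT : bounded_op ip T) :
  let RT := rspace ip T in
  let cond1 (E : V -> V) := exists a1 a2 : R, [/\ 0 < a1, 0 < a2,
        (forall xi : V, a1 * hnorm ip (E xi) <= hnorm ip (T (E xi)))
      & (forall xi : V, a2 * hnorm ip (xi - E xi) <= hnorm ip (T (xi - E xi)))] in
  let cond2 (E : V -> V) :=
      invertible_in ip RT (fun y => rproj ip (T \o E) y
                                   - rproj ip (fun x => T (x - E x)) y) in
  (invertible_onto ip RT T <->
     exists E : V -> V, [/\ is_projection ip E, cond1 E & cond2 E]) /\
  (forall E : V -> V, is_projection ip E -> forall a1 a2 : R,
     0 < a1 -> 0 < a2 ->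
     (forall xi : V, a1 * hnorm ip (E xi) <= hnorm ip (T (E xi))) ->
     (forall xi : V, a2 * hnorm ip (xi - E xi) <= hnorm ip (T (xi - E xi))) ->
     cond2 E ->
     forall Tinv : V -> V, is_inverse_onto ip RT T Tinv ->
       let c := Num.sqrt (1 - opnorm ip (rproj ip (T \o E)
                              \o rproj ip (fun x => T (x - E x))))
                 * opnorm_on ip RT Tinv in
       (opnorm ip T)^-1 <= c /\ c <= (Num.min a1 a2)^-1).
Proof.
move=> RT cond1 cond2; split; last first.
  by move=> E pE a1 a2 a10 a20 h1 h2 _ Tinv hTi; exact: inverse_norm_bounds.
split=> [|[E [pE [a1 [a2 [a10 a20 h1 h2]]]]]]; first exact: invertible_cond.
exact: cond_invertible h1 h2.
Qed.
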